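(* There exist no totally geodesic proper QGCR-lightlike submanifolds $(M,g,S(TM),S(TM^\perp))$ of an indefinite nearly Sasakian manifold $(\overline{M},\overline{\phi},\eta,\xi,\overline{g})$ with the structure vector field $\xi$ tangent to $M$ (that is, $\xi\in\Gamma(TM)$ along $M$).
   Context: Notation: $\Gamma(\Xi)$ is the set of smooth sections of a vector bundle $\Xi$. Indefinite nearly Sasakian manifold: a $(2n+1)$-dimensional manifold $\overline{M}$ with a $(1,1)$-tensor $\overline{\phi}$, a vector field $\xi$, a 1-form $\eta$ and a semi-Riemannian metric $\overline{g}$ with Levi-Civita connection $\overline{\nabla}$ such that $\overline{\phi}^2=-I+\eta\otimes\xi$, $\eta(\xi)=1$, $\eta\circ\overline{\phi}=0$, $\overline{\phi}\xi=0$, $\overline{g}(\overline{\phi}X,\overline{\phi}Y)=\overline{g}(X,Y)-\eta(X)\eta(Y)$ (hence $\eta=\overline{g}(\xi,\cdot)$), and $(\overline{\nabla}_X\overline{\phi})Y+(\overline{\nabla}_Y\overline{\phi})X=2\overline{g}(X,Y)\xi-\eta(Y)X-\eta(X)Y$ for all $X,Y$. Lightlike submanifold: a submanifold $M$ of $\overline{M}$, with $g$ the induced (degenerate) metric, such that $\mathrm{Rad}\,TM=TM\cap TM^\perp$ is a smooth distribution of rank $r>0$. A screen distribution $S(TM)$ is a semi-Riemannian (non-degenerate) complement of $\mathrm{Rad}\,TM$ in $TM$; $S(TM^\perp)$ is a semi-Riemannian complement of $\mathrm{Rad}\,TM$ in $TM^\perp$. The lightlike transversal bundle $l\mathrm{tr}(TM)$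 is locally spanned by null sections $N_i$ of the orthogonal complement of $S(TM^\perp)$ in $S(TM)^\perp$ with $\overline{g}(E_i,N_j)=\delta_{ij}$, $\overline g(N_i,N_j)=0$ for a local basis $\{E_i\}$ of $\mathrm{Rad}\,TM$. Put $\mathrm{tr}(TM)=l\mathrm{tr}(TM)\perp S(TM^\perp)$, so $T\overline{M}|_M=TM\oplus\mathrm{tr}(TM)=S(TM)\perp S(TM^\perp)\perp\{\mathrm{Rad}\,TM\oplus l\mathrm{tr}(TM)\}$. The Gauss formula is $\overline{\nabla}_XY=\nabla_XY+h(X,Y)$ for $X,Y\in\Gamma(TM)$, with $\nabla_XY\in\Gamma(TM)$ and $h(X,Y)\in\Gamma(\mathrm{tr}(TM))$ (the second fundamental form). $M$ is totally geodesic if $h=0$. QGCR-lightlike submanifold: a lightlike submanifold $(M,g,S(TM),S(TM^\perp))$ of $\overline{M}$ is Quasi Generalized Cauchy-Riemann (QGCR) if (i) there are distributions $D_1,D_2$ of $\mathrm{Rad}\,TM$ with $\mathrm{Rad}\,TM=D_1\oplus D_2$, $\overline{\phi}D_1=D_1$, $\overline{\phi}D_2\subset S(TM)$; (ii) there are subbundles $D_0,\overline{D}$ of $S(TM)$ with $S(TM)=\{\overline{\phi}D_2\oplus\overline{D}\}\perp D_0$, $\overline{\phi}D_0\subseteq D_0$, $\overline{D}=\overline{\phi}\mathcal{S}\oplus\overline{\phi}\mathcal{L}$, where $D_0$ is non-degenerate and $\mathcal{L}$, $\mathcal{S}$ are vector subbundles of $l\mathrm{tr}(TM)$ and $S(TM^\perp)$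 respectively. In (ii) the symbol $\oplus$ denotes a (not necessarily orthogonal) sum of subbundles, and the summands $\overline{\phi}D_2$ and $\overline{\phi}\mathcal{L}$ are allowed to intersect. $M$ is proper if $D_0,D_1,D_2,\mathcal{S}$ are all nonzero. *)

(* Defs.v *)
From mathcomp Require Import all_boot all_order all_algebra.
From mathcomp Require Import all_classical all_reals all_analysis.
Set Implicit Arguments.
Unset Strict Implicit.
Unset Printing Implicit Defensive.
Import Order.TTheory GRing.Theory Num.Theory.
Import numFieldNormedType.Exports.
Local Open Scope classical_set_scope.
Local Open Scope ring_scope.

(* C^infinity on an open set U: every iterated directional derivative exists
   and is Frechet differentiable at every point of U. *)
Definition smooth_on (R : realType) (m : nat) (V : normedModType R)
    (U : set 'rV[R]_m) (h : 'rV[R]_m -> V) : Prop :=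
  forall (vs : seq 'rV[R]_m) (x : 'rV[R]_m), U x ->
    differentiable (foldr (fun v k => 'D_v k) h vs) x.

(* [cmap] and [cinv] are total functions; only their values on [dom] and on
   its image are meaningful. *)
Record chart (R : realType) (T : topologicalType) (d : nat) := Chart {
  dom : set T;
  cmap : T -> 'rV[R]_d;
  cinv : 'rV[R]_d -> T;
  dom_open : open dom;
  img_open : open (cmap @` dom);
  cmapK : forall p, dom p -> cinv (cmap p) = p;
  cmap_continuous : {within dom, continuous cmap};
  cinv_continuous : {within cmap @` dom, continuous cinv} }.

(* A smooth atlas with a preferred chart [chart_at p] around each point.  The
   preferred chart identifies the tangent space at p with 'rV[R]_d, so tangent
   vectors are row vectors, a vector field is a function into 'rV[R]_d, and
   distributions take values in {vspace 'rV[R]_d}.  The preferred charts need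
   not vary continuously: smoothness of a field is always read off in a fixed
   chart, through [tcoord] below. *)
Record manifold (R : realType) (d : nat) := Manifold {
  pts :> topologicalType;
  atlas : set (chart R pts d);
  chart_at : pts -> chart R pts d;
  pts_hausdorff : hausdorff_space pts;
  pts_second_countable : @second_countable pts;
  chart_at_atlas : forall p, atlas (chart_at p);
  chart_at_dom : forall p, dom (chart_at p) p;
  atlas_compat : forall a c, atlas a -> atlas c ->
    smooth_on (cmap a @` (dom a `&` dom c)) (cmap c \o cinv a) }.

Section Fields.
Context (R : realType) (d : nat) (N : manifold R d).

(* Components in the chart c of the tangent vector v at p, and conversely the
   tangent vector at p with components w in the chart c (p in the domain). *)
Definition tcoord (c : chart R N d) (p : N) (v : 'rV[R]_d) : 'rV[R]_d :=
  'd (cmap c \o cinv (chart_at p)) (cmap (chart_at p) p) v.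

Definition tvec (c : chart R N d) (p : N) (w : 'rV[R]_d) : 'rV[R]_d :=
  'd (cmap (chart_at p) \o cinv c) (cmap c p) w.

Definition coord_field (c : chart R N d) (i : 'I_d) (p : N) : 'rV[R]_d :=
  tvec c p (delta_mx 0 i).

Definition smooth_fun (W : set N) (h : N -> R^o) : Prop :=
  forall a, atlas a -> smooth_on (cmap a @` (W `&` dom a)) (h \o cinv a).

(* tensors of type (1,1), (0,1) and (0,2) *)
Definition endo_field := N -> 'End('rV[R]_d).
Definition one_form := N -> 'Hom('rV[R]_d, R^o).
Definition bilin_field := N -> 'Hom('rV[R]_d, 'Hom('rV[R]_d, R^o)).
End Fields.

Section Along.
Context (R : realType) (m d : nat) (M : manifold R m) (N : manifold R d).

Definition smooth_map (f : M -> N) : Prop :=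
  continuous f /\
  forall a c, atlas a -> atlas c ->
    smooth_on (cmap a @` (dom a `&` f @^-1` dom c)) (cmap c \o f \o cinv a).

Definition tangent_map (f : M -> N) (p : M) : 'Hom('rV[R]_m, 'rV[R]_d) :=
  linfun ('d (cmap (chart_at (f p)) \o f \o cinv (chart_at p))
             (cmap (chart_at p) p)).

(* s is a section over W of the pulled back tangent bundle f^*TN, that is,
   s q is tangent to N at f q. *)
Definition smooth_section (f : M -> N) (W : set M) (s : M -> 'rV[R]_d) : Prop :=
  forall a c, atlas a -> atlas c ->
    smooth_on (cmap a @` (W `&` dom a `&` f @^-1` dom c))
      (fun x => tcoord c (f (cinv a x)) (s (cinv a x))).

(* smooth rank k subbundle of f^*TN *)
Definition subbundle_rank (f : M -> N) (k : nat) (D : M -> {vspace 'rV[R]_d}) :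
    Prop :=
  forall p, exists W : set M, exists s : 'I_k -> M -> 'rV[R]_d,
    [/\ open W, W p, forall i, smooth_section f W (s i) &
        forall q, W q -> basis_of (D q) [tuple s i q | i < k]].

Definition subbundle (f : M -> N) (D : M -> {vspace 'rV[R]_d}) : Prop :=
  exists k, subbundle_rank f k D.

Definition nonzero_bundle (D : M -> {vspace 'rV[R]_d}) : Prop :=
  exists p, D p <> 0%VS.
End Along.

Section LinearAlgebra.
Context (R : realType) (d : nat).
Implicit Types (b : 'Hom('rV[R]_d, 'Hom('rV[R]_d, R^o))).
Implicit Types (U V A B : {vspace 'rV[R]_d}).

Definition nondegenerate_on b V : Prop :=
  forall u, u \in V -> (forall v, v \in V -> b u v = 0) -> u = 0.

Definition orthogonal_to b U V : Prop :=
  forall u v, u \in U -> v \in V -> b u v = 0.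

(* { u | b v u = 0 for all v in V } *)
Definition orthv b V : {vspace 'rV[R]_d} :=
  (\bigcap_(v <- vbasis V) lker (b v))%VS.

Definition negative_on b V : Prop :=
  forall v, v \in V -> v <> 0 -> b v v < 0.

Definition has_index b (nu : nat) : Prop :=
  (exists V, negative_on b V /\ \dim V = nu) /\
  (forall V, negative_on b V -> (\dim V <= nu)%N).

Definition direct_sum V A B : Prop := (A + B)%VS = V /\ (A :&: B)%VS = 0%VS.
End LinearAlgebra.

Section LeviCivita.
Context (R : realType) (d : nat) (N : manifold R d) (g : bilin_field N).

Definition semi_riemannian : Prop :=
  [/\ forall c i j, atlas c -> smooth_fun (dom c)
        (fun p => g p (coord_field c i p) (coord_field c j p)),
      forall p u v, g p u v = g p v u,
      forall p, nondegenerate_on (g p) fullv &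
      exists nu, forall p, has_index (g p) nu].

Definition metric_coef (c : chart R N d) (x : 'rV[R]_d) : 'M[R]_d :=
  \matrix_(i, j)
    g (cinv c x) (coord_field c i (cinv c x)) (coord_field c j (cinv c x)).

Definition partial_metric (c : chart R N d) (k i j : 'I_d) (x : 'rV[R]_d) : R :=
  'D_(delta_mx 0 k) (fun y => metric_coef c y i j : R^o) x.

(* Christoffel symbol Gamma^k_ij of the Levi-Civita connection of g *)
Definition christoffel (c : chart R N d) (x : 'rV[R]_d) (k i j : 'I_d) : R :=
  2^-1 * \sum_l invmx (metric_coef c x) k l *
    (partial_metric c i j l x + partial_metric c j i l x
     - partial_metric c l i j x).

Definition christoffel_term (c : chart R N d) (x u v : 'rV[R]_d) : 'rV[R]_d :=
  \row_k \sum_i \sum_j christoffel c x k i j * u 0 i * v 0 j.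

(* Levi-Civita covariant derivative, at p and in the direction u tangent to M
   at p, of a section Y of f^*TN, computed in the preferred charts at p and at
   f p:
     (nabla_u Y)^k = u(Y^k) + Gamma^k_ij (df u)^i Y^j.
   For f the identity of N this is the Levi-Civita connection of N; for f an
   immersion it is that connection applied to vector fields along M. *)
Definition nabla (m : nat) (M : manifold R m) (f : M -> N)
    (Y : M -> 'rV[R]_d) (p : M) (u : 'rV[R]_m) : 'rV[R]_d :=
  let a := chart_at p in
  let c := chart_at (f p) in
  'd (fun x => tcoord c (f (cinv a x)) (Y (cinv a x))) (cmap a p) u
  + christoffel_term c (cmap c (f p)) (tangent_map f p u) (Y p).

(* (nabla_X phi) Y = nabla_X (phi Y) - phi (nabla_X Y) at p *)
Definition nabla_endo (phi : endo_field N) (X Y : N -> 'rV[R]_d) (p : N) :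
    'rV[R]_d :=
  nabla idfun (fun q => phi q (Y q)) p (X p) - phi p (nabla idfun Y p (X p)).
End LeviCivita.

(* The dimension d is fixed to be odd in the theorem.  The last clause is a
   tensor identity; it is imposed on all local smooth vector fields. *)
Record indefinite_nearly_sasakian (R : realType) (d : nat) (N : manifold R d)
    (phi : endo_field N) (xi : N -> 'rV[R]_d) (eta : one_form N)
    (g : bilin_field N) : Prop := IndefiniteNearlySasakian {
  ins_metric : semi_riemannian g;
  ins_phi_smooth : forall c i, atlas c ->
    smooth_section idfun (dom c) (fun p => phi p (coord_field c i p));
  ins_xi_smooth : smooth_section idfun setT xi;
  ins_eta_smooth : forall c i, atlas c ->
    smooth_fun (dom c) (fun p => eta p (coord_field c i p));
  ins_phi2 : forall p v, phi p (phi p v) = - v + eta p v *: xi p;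
  ins_eta_xi : forall p, eta p (xi p) = 1;
  ins_eta_phi : forall p v, eta p (phi p v) = 0;
  ins_phi_xi : forall p, phi p (xi p) = 0;
  ins_compat : forall p u v,
    g p (phi p u) (phi p v) = g p u v - eta p u * eta p v;
  ins_nearly_sasakian : forall (W : set N) (X Y : N -> 'rV[R]_d), open W ->
    smooth_section idfun W X -> smooth_section idfun W Y ->
    forall p, W p ->
      nabla_endo g phi X Y p + nabla_endo g phi Y X p =
      (2 * g p (X p) (Y p)) *: xi p - eta p (Y p) *: X p - eta p (X p) *: Y p }.

Section Submanifold.
Context (R : realType) (m d : nat) (M : manifold R m) (N : manifold R d).
Context (g : bilin_field N) (f : M -> N).

(* injectively immersed submanifold f : M -> N *)
Definition submanifold : Prop :=
  [/\ smooth_map f, injective f & forall p, lker (tangent_map f p) = 0%VS].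

(* TM, TM^perp and Rad TM as subbundles of f^*TN *)
Definition TM (p : M) : {vspace 'rV[R]_d} := limg (tangent_map f p).
Definition TMperp (p : M) : {vspace 'rV[R]_d} := orthv (g (f p)) (TM p).
Definition Rad (p : M) : {vspace 'rV[R]_d} := (TM p :&: TMperp p)%VS.

(* S is a semi-Riemannian complement of Rad TM in B; this is a screen
   distribution S(TM) for B = TM, and S(TM^perp) for B = TM^perp. *)
Definition is_screen (B S : M -> {vspace 'rV[R]_d}) : Prop :=
  [/\ subbundle f S, forall p, direct_sum (B p) (Rad p) (S p) &
      forall p, nondegenerate_on (g (f p)) (S p)].

Definition is_ltr (r : nat) (STM STMperp ltr : M -> {vspace 'rV[R]_d}) : Prop :=
  forall p, exists W : set M, exists E N' : 'I_r -> M -> 'rV[R]_d,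
    [/\ open W, W p,
        forall i, smooth_section f W (E i) /\ smooth_section f W (N' i) &
        forall q, W q ->
          [/\ basis_of (Rad q) [tuple E i q | i < r],
              basis_of (ltr q) [tuple N' i q | i < r],
              forall i, N' i q \in orthv (g (f q)) (STM q) /\
                        N' i q \in orthv (g (f q)) (STMperp q),
              forall i j, g (f q) (E i q) (N' j q) = (i == j)%:R &
              forall i j, g (f q) (N' i q) (N' j q) = 0]].

Definition lightlike_submanifold (STM STMperp ltr : M -> {vspace 'rV[R]_d}) :
    Prop :=
  submanifold /\
  exists r : nat,
    [/\ (0 < r)%N, subbundle_rank f r Rad, is_screen TM STM,
        is_screen TMperp STMperp & is_ltr r STM STMperp ltr].

Definition tr (STMperp ltr : M -> {vspace 'rV[R]_d}) (p : M) :
    {vspace 'rV[R]_d} := (ltr p + STMperp p)%VS.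

(* The tr(TM)-component, along TM, of nabla_X Y.  Here X and Y are sections of
   TM viewed inside f^*TN, so X p is first pulled back to the tangent space of
   M at p. *)
Definition second_fundamental_form (STMperp ltr : M -> {vspace 'rV[R]_d})
    (X Y : M -> 'rV[R]_d) (p : M) : 'rV[R]_d :=
  daddv_pi (tr STMperp ltr p) (TM p)
    (nabla g f Y p ((tangent_map f p)^-1%VF (X p))).

(* h = 0, tested on all local sections X, Y of TM *)
Definition totally_geodesic (STMperp ltr : M -> {vspace 'rV[R]_d}) : Prop :=
  forall (W : set M) (X Y : M -> 'rV[R]_d), open W ->
    smooth_section f W X -> smooth_section f W Y ->
    (forall q, W q -> X q \in TM q /\ Y q \in TM q) ->
    forall p, W p -> second_fundamental_form STMperp ltr X Y p = 0.

(* The sums in (ii) are not required to be direct, apart from the orthogonal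
   splitting off of D0, which is direct because D0 is non-degenerate. *)
Record qgcr_data (phi : endo_field N) (STM STMperp ltr : M -> {vspace 'rV[R]_d})
    (D1 D2 D0 Dbar L S : M -> {vspace 'rV[R]_d}) : Prop := QGCRData {
  qgcr_D1 : subbundle f D1;
  qgcr_D2 : subbundle f D2;
  qgcr_rad : forall p, direct_sum (Rad p) (D1 p) (D2 p);
  qgcr_phiD1 : forall p, (phi (f p) @: D1 p)%VS = D1 p;
  qgcr_phiD2 : forall p, (phi (f p) @: D2 p <= STM p)%VS;
  qgcr_D0 : subbundle f D0;
  qgcr_Dbar : subbundle f Dbar;
  qgcr_L : subbundle f L;
  qgcr_S : subbundle f S;
  qgcr_L_sub : forall p, (L p <= ltr p)%VS;
  qgcr_S_sub : forall p, (S p <= STMperp p)%VS;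
  qgcr_screen : forall p, STM p = (phi (f p) @: D2 p + Dbar p + D0 p)%VS;
  qgcr_orth : forall p,
    orthogonal_to (g (f p)) (phi (f p) @: D2 p + Dbar p)%VS (D0 p);
  qgcr_phiD0 : forall p, (phi (f p) @: D0 p <= D0 p)%VS;
  qgcr_D0_nondeg : forall p, nondegenerate_on (g (f p)) (D0 p);
  qgcr_Dbar_eq : forall p,
    Dbar p = (phi (f p) @: S p + phi (f p) @: L p)%VS }.

Definition proper_qgcr (phi : endo_field N)
    (STM STMperp ltr : M -> {vspace 'rV[R]_d}) : Prop :=
  exists D1 D2 D0 Dbar L S : M -> {vspace 'rV[R]_d},
    qgcr_data phi STM STMperp ltr D1 D2 D0 Dbar L S /\
    [/\ nonzero_bundle D0, nonzero_bundle D1, nonzero_bundle D2 &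
        nonzero_bundle S].

Definition tangent_to (xi : N -> 'rV[R]_d) : Prop :=
  forall p, xi (f p) \in TM p.
End Submanifold.

(* Main.v *)
(* Let W be a section of the bundle S inside S(TM^perp).  As xi is tangent to M,
   eta W = 0, so X = phi W is a tangent field with phi X = - W.  The nearly
   Sasakian identity on the pair (X, X) reads
   nabla_X (phi X) - phi (nabla_X X) = g(X, X) xi, and pairing it with xi yields
   g(W, nabla_X xi) = g(W, W).  If h = 0 then nabla_X xi is tangent to M, hence
   orthogonal to W, so every vector of S is null and, by polarization, S is
   totally isotropic.  Then phi S is orthogonal to phi D2, phi L, phi S and D0,
   which together span the non-degenerate S(TM); so phi S = 0, and S = 0 because
   phi^2 = -1 on ker eta.  This contradicts properness. *)
Require Import Defs.
From mathcomp Require Import all_boot all_order all_algebra.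
From mathcomp Require Import all_classical all_reals all_analysis.
From mathcomp Require Import ring lra.
Import Order.TTheory GRing.Theory Num.Theory.
Import numFieldNormedType.Exports.
Set Implicit Arguments.
Unset Strict Implicit.
Unset Printing Implicit Defensive.
Local Open Scope classical_set_scope.
Local Open Scope ring_scope.

(** * Linear algebra of lightlike complements *)

Section OrthogonalComplement.
Context (R : realType) (d : nat).
Implicit Types (b : 'Hom('rV[R]_d, 'Hom('rV[R]_d, R^o))).
Implicit Types U V T : {vspace 'rV[R]_d}.

Lemma bilinDr b u v w : b u (v + w) = b u v + b u w.
Proof. by rewrite linearD. Qed.

Lemma bilinDl b u v w : b (u + v) w = b u w + b v w.
Proof. by rewrite linearD add_lfunE. Qed.

Lemma bilinZr b u (a : R) v : b u (a *: v) = a * b u v.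
Proof. by rewrite linearZ. Qed.

Lemma bilinZl b (a : R) u v : b (a *: u) v = a * b u v.
Proof. by rewrite linearZ scale_lfunE. Qed.

Lemma bilin_sumr b u (I : Type) (s : seq I) (P : pred I) (v : I -> 'rV[R]_d) :
  b u (\sum_(i <- s | P i) v i) = \sum_(i <- s | P i) b u (v i).
Proof. by rewrite linear_sum. Qed.

Lemma bilin_suml b v (I : Type) (s : seq I) (P : pred I) (u : I -> 'rV[R]_d) :
  b (\sum_(i <- s | P i) u i) v = \sum_(i <- s | P i) b (u i) v.
Proof. by rewrite linear_sum sum_lfunE. Qed.

Lemma basis_tuple_mem U r (F : 'I_r -> 'rV[R]_d) :
  basis_of U [tuple F i | i < r] -> forall i, F i \in U.
Proof. by move=> bF i; apply: (basis_mem bF); apply: map_f; rewrite mem_enum. Qed.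

Lemma basis_tuple_sum U r (F : 'I_r -> 'rV[R]_d) v :
  basis_of U [tuple F i | i < r] -> v \in U ->
  exists a : 'I_r -> R, v = \sum_i a i *: F i.
Proof.
move=> bF Uv; exists (fun i => coord [tuple F i | i < r] i v).
rewrite {1}(coord_basis bF Uv); apply: eq_bigr => i _.
by rewrite -tnth_nth tnth_mktuple.
Qed.

(** [orthv] tests only the vectors of a basis of [V]; bilinearity extends the vanishing to all of
    [V]. *)
Lemma mem_orthv b V v : v \in orthv b V <-> forall w, w \in V -> b w v = 0.
Proof.
rewrite /orthv; split=> [vb w Vw|bv].
  have {}vb i : b (vbasis V)`_i v = 0.
    case: (ltnP i (size (vbasis V))) => [ltiV|leVi]; last first.
      (* Past the end of the basis, the default value of [nth] is the zero vector. *)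
      by rewrite nth_default // linear0 zero_lfunE.
    move: vb; rewrite (big_nth 0) big_mkord (bigD1 (Ordinal ltiV)) //=.
    by rewrite memv_cap memv_ker => /andP[/eqP].
  rewrite (coord_vbasis Vw) linear_sum sum_lfunE big1 // => i _.
  by rewrite linearZ scale_lfunE vb scaler0.
rewrite big_seq; elim/big_rec: _ => [|u U uV IH]; first exact: memvf.
by rewrite memv_cap IH andbT memv_ker bv // vbasis_mem.
Qed.

(** Each basis vector of [V] imposes one linear condition, so the dimension drops by at most one per
    vector. Only an inequality holds in general, as [b] may be degenerate. *)
Lemma dim_orthv_ge b V : (d <= \dim V + \dim (orthv b V))%N.
Proof.
rewrite /orthv -[X in (_ <= X + _)%N](size_tuple (vbasis V)).
elim: (tval (vbasis V)) => [|v s IH].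
  by rewrite big_nil dimvf /= dim_matrix mul1r.
rewrite big_cons capvC /=; set U := (\bigcap_(j <- s) _)%VS in IH *.
have := limg_ker_dim (b v) U.
have : (\dim (b v @: U) <= 1)%N.
  by apply: leq_trans (dimvS (subvf _)) _; rewrite dimvf.
move=> h1 h2; rewrite -h2 in IH; apply: leq_trans IH _.
by rewrite addSnnS leq_add2l -[X in (_ <= X)%N]addn1 leq_add2l.
Qed.

(** Pairing with [E i] reads off the i-th coordinate of [v] in the basis [N]. *)
Lemma dual_basis_ltr_eq0 b r (E N : 'I_r -> 'rV[R]_d) U v :
  basis_of U [tuple N i | i < r] ->
  (forall i j, b (E i) (N j) = (i == j)%:R) ->
  v \in U -> (forall i, b (E i) v = 0) -> v = 0.
Proof.
move=> bN EN Uv; have [a ->] := basis_tuple_sum bN Uv => bE.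
apply: big1 => i _; move: (bE i); rewrite bilin_sumr (bigD1 i) //= big1.
  by rewrite bilinZr EN eqxx addr0 mulr1 => ->; rewrite scale0r.
by move=> j neji; rewrite bilinZr EN eq_sym (negPf neji) mulr0.
Qed.

(** Here [T] stands for TM, [S] for the screen of its orthogonal and [L] for the lightlike
    transversal bundle. Pairing a vector of [(L + S) :&: T] with the radical frame [E] shows that
    its [L]-part vanishes; the rest lies in [S] and in the radical. Spanning is a dimension count:
    [L] has the dimension of the radical, so [L + S] has that of [orthv b T]. *)
Lemma transversal_complement b T S L r (E N : 'I_r -> 'rV[R]_d) :
  (forall u v, b u v = b v u) ->
  direct_sum (orthv b T) (T :&: orthv b T) S ->
  basis_of (T :&: orthv b T)%VS [tuple E i | i < r] ->
  basis_of L [tuple N i | i < r] ->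
  (forall i j, b (E i) (N j) = (i == j)%:R) ->
  ((L + S) :&: T = 0)%VS /\ ((L + S) + T = fullv)%VS.
Proof.
move=> bC [PRS RS0] bE bN EN.
have SP v : v \in S -> v \in orthv b T.
  by rewrite -PRS => Sv; apply: (subvP (addvSr _ _)).
have ET i : E i \in T.
  by have := basis_tuple_mem bE i; rewrite memv_cap => /andP[].
have EP i : E i \in orthv b T.
  by have := basis_tuple_mem bE i; rewrite memv_cap => /andP[].
have ES i s : s \in S -> b (E i) s = 0.
  by move=> /SP /mem_orthv; apply.
have LS0 : (L :&: S = 0)%VS.
  apply/eqP; rewrite -subv0; apply/subvP => v; rewrite memv_cap => /andP[Lv Sv].
  by rewrite memv0; apply/eqP/(dual_basis_ltr_eq0 bN EN Lv) => i; apply: ES.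
have LST0 : ((L + S) :&: T = 0)%VS.
  apply/eqP; rewrite -subv0; apply/subvP => v; rewrite memv_cap.
  move=> /andP[/memv_addP[l Ll [s Ss ->]] Tv].
  have l0 : l = 0.
    apply: (dual_basis_ltr_eq0 bN EN Ll) => i; apply/eqP.
    have /mem_orthv/(_ _ Tv) := EP i; rewrite bC linearD /= (ES i s Ss) addr0.
    by move->.
  move: Tv; rewrite l0 add0r => Ts.
  by rewrite -RS0 memv_cap Ss andbT memv_cap Ts SP.
split=> //; apply/eqP; rewrite eqEdim subvf dimvf /= dim_matrix mul1r.
rewrite (dimv_disjoint_sum LST0) (dimv_disjoint_sum LS0).
rewrite (size_basis bN) -(size_basis bE) -(dimv_disjoint_sum RS0) PRS addnC.
exact: dim_orthv_ge.
Qed.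

Lemma daddv_pi_eq0 U V v :
  (U :&: V = 0)%VS -> (U + V = fullv)%VS -> daddv_pi U V v = 0 -> v \in V.
Proof.
move=> UV0 UVf piv; have Uv : v \in (U + V)%VS by rewrite UVf memvf.
by rewrite -(daddv_pi_add UV0 Uv) piv add0r memv_pi.
Qed.

End OrthogonalComplement.

(** * Smoothness and charts *)

Section SmoothOn.
Context (R : realType) (m : nat) (V : normedModType R).
Implicit Types (U : set 'rV[R]_m) (h : 'rV[R]_m -> V).

(** The first-order expansion at [x] depends only on the germ of the function, and uniqueness of the
    differential identifies the two linear maps. *)
Lemma near_eq_is_diff (V1 V2 : normedModType R) (f g : V1 -> V2) x :
  (\near x, f x = g x) -> differentiable f x -> is_diff x g ('d f x).
Proof.
move=> fg df; have dg : g \o shift x = cst (g x) + 'd f x +o_ 0 id.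
  apply/eqaddoP => e e0.
  have /eqaddoP/(_ _ e0) := diff_locally df.
  have fg0 : \forall y \near (0 : V1), f (y + x) = g (y + x).
    by rewrite (near_shift x) sub0r; near=> y; rewrite /= subrK; near: y.
  apply: filterS2 fg0 => y fgy /=.
  rewrite /GRing.add /= /Algebra.opp /=.
  by rewrite /cst /= fgy (nbhs_singleton fg).
have dgf : 'd g x = 'd f x :> (V1 -> V2).
  by apply: diff_unique => //; exact: diff_continuous.
by split=> //; apply/diff_locallyP; rewrite dgf; split=> //; exact: diff_continuous.
Unshelve. all: by end_near. Qed.

Lemma near_eq_differentiable (V1 V2 : normedModType R) (f g : V1 -> V2) x :
  (\near x, f x = g x) -> differentiable f x -> differentiable g x.
Proof. by move=> fg /(near_eq_is_diff fg)[]. Qed.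

Lemma near_eq_diff (V1 V2 : normedModType R) (f g : V1 -> V2) x :
  (\near x, f x = g x) -> differentiable f x -> 'd g x = 'd f x :> (V1 -> V2).
Proof. by move=> fg /(near_eq_is_diff fg)[]. Qed.

Lemma smooth_on_sub U U' h : U' `<=` U -> smooth_on U h -> smooth_on U' h.
Proof. by move=> UU' hU vs x /UU'; apply: hU. Qed.

Lemma smooth_on_differentiable U h x : smooth_on U h -> U x -> differentiable h x.
Proof. by move=> /(_ [::]); apply. Qed.

(** Openness of [U] lets the equality be differentiated again at each step of the induction on the
    directions. *)
Lemma smooth_on_eq U h1 h2 : open U -> (forall x, U x -> h1 x = h2 x) ->
  smooth_on U h1 -> smooth_on U h2.
Proof.
move=> oU h12 sh1 vs.
have E : forall x, U x ->
    foldr (fun v k => 'D_v k) h1 vs x = foldr (fun v k => 'D_v k) h2 vs x.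
  elim: vs => [|v vs IH] //= x Ux; apply: near_eq_derive.
  exact: filterS IH (open_nbhs_nbhs (conj oU Ux)).
move=> x Ux; apply: near_eq_differentiable (sh1 vs x Ux).
exact: filterS E (open_nbhs_nbhs (conj oU Ux)).
Qed.

Lemma smooth_on0 U : smooth_on U (fun=> 0 : V).
Proof.
move=> vs x _; suff -> : foldr (fun v k => 'D_v k) (fun=> 0 : V) vs = cst 0.
  exact: differentiable_cst.
elim: vs => [|v vs IH] //=; apply: etrans (congr1 (fun k => 'D_v k) IH) _.
by apply/funext => y; rewrite derive_cst.
Qed.

Lemma smooth_on_lin U (k : R) h1 h2 : open U -> smooth_on U h1 ->
  smooth_on U h2 -> smooth_on U (fun x => k *: h1 x + h2 x).
Proof.
move=> oU sh1 sh2 vs.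
pose D h := foldr (fun v k => 'D_v k) h vs.
have E : forall x, U x -> (k *: D h1 + D h2) x = D (fun x => k *: h1 x + h2 x) x.
  rewrite /D; elim: vs {D} => [|v vs IH] //= x Ux.
  have d1 := @diff_derivable _ _ _ _ _ v (sh1 vs x Ux).
  have d2 := @diff_derivable _ _ _ _ _ v (sh2 vs x Ux).
  rewrite -(near_eq_derive v (filterS IH (open_nbhs_nbhs (conj oU Ux)))).
  by rewrite deriveD ?deriveZ //; exact: derivableZ.
move=> x Ux; apply: (@near_eq_differentiable _ _ (k *: D h1 + D h2)).
  exact: filterS E (open_nbhs_nbhs (conj oU Ux)).
by apply: differentiableD; [apply: differentiableZ; exact: sh1|exact: sh2].
Qed.

Lemma smooth_on_sum U r (k : 'I_r -> R) (h : 'I_r -> 'rV[R]_m -> V) : open U ->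
  (forall i, smooth_on U (h i)) -> smooth_on U (fun x => \sum_i k i *: h i x).
Proof.
(* Unlocking turns the sum into a fold over a list, on which induction applies. *)
move=> oU sh; rewrite unlock; elim: (index_enum _) => [|i s IH] /=.
  exact: smooth_on0.
exact: smooth_on_lin.
Qed.

End SmoothOn.

(** * Passing between a manifold and its charts *)

Section Charts.
Context (R : realType).

Lemma open_cmap_dom (T : topologicalType) d (c : chart R T d) :
  open (cmap c @` dom c).
Proof. exact: img_open. Qed.

Lemma cinv_cvg (T : topologicalType) d (c : chart R T d) x :
  (cmap c @` dom c) x -> {for x, continuous (cinv c)}.
Proof.
move=> ix; have : {within cmap c @` dom c, continuous (cinv c)}.
  by move=> y; exact: cinv_continuous.
rewrite continuous_open_subspace; last exact: open_cmap_dom.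
by apply; rewrite inE.
Qed.

(** Carries a property holding near [p] over to the coordinates near [cmap c p], where differentials
    are computed. *)
Lemma chart_nbhs (T : topologicalType) d (c : chart R T d) (A : set T) p :
  nbhs p A -> dom c p ->
  \forall x \near cmap c p, A (cinv c x) /\ (cmap c @` dom c) x.
Proof.
move=> Ap cp; have ip : (cmap c @` dom c) (cmap c p) by exists p.
have np := open_nbhs_nbhs (conj (open_cmap_dom (c := c)) ip).
by apply: filterI np; apply: cinv_cvg => //; rewrite cmapK.
Qed.

Lemma open_chart_image (T : topologicalType) d (c : chart R T d) (A : set T) :
  open A -> open (cmap c @` (A `&` dom c)).
Proof.
move=> oA; rewrite openE => _ [p [Ap cp] <-].
apply: filterS (chart_nbhs (open_nbhs_nbhs (conj oA Ap)) cp) => x [Acx [q cq qx]].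
by exists q => //; split=> //; move: Acx; rewrite -qx cmapK.
Qed.

Lemma cinvK (T : topologicalType) d (c : chart R T d) x :
  (cmap c @` dom c) x -> cmap c (cinv c x) = x.
Proof. by move=> [p cp <-]; rewrite cmapK. Qed.

Lemma smooth_section_sub m d (M : manifold R m) (N : manifold R d) (f : M -> N)
    (W W' : set M) s :
  W' `<=` W -> smooth_section f W s -> smooth_section f W' s.
Proof.
move=> WW' sW a c aa cc; apply: smooth_on_sub (sW a c aa cc).
by apply: image_subset => p [[/WW' ? ?] ?].
Qed.

Lemma open_section_domain m d (M : manifold R m) (N : manifold R d) (f : M -> N)
    (W : set M) (a : chart R M m) (c : chart R N d) :
  continuous f -> open W -> open (cmap a @` (W `&` dom a `&` f @^-1` dom c)).
Proof.
move=> fc oW; rewrite setIAC; apply: open_chart_image; apply: openI oW _.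
by apply: open_comp (@dom_open _ _ _ c) => x _; exact: fc.
Qed.

(** [tcoord] is linear in the vector, so constant coefficients pass through it. This extends a
    single vector to a local section: expand it in a local frame and freeze the coefficients. *)
Lemma smooth_section_sum m d (M : manifold R m) (N : manifold R d) (f : M -> N)
    (W : set M) r (k : 'I_r -> R) (s : 'I_r -> M -> 'rV[R]_d) :
  continuous f -> open W -> (forall i, smooth_section f W (s i)) ->
  smooth_section f W (fun q => \sum_i k i *: s i q).
Proof.
move=> fc oW sW a c aa cc; have oU := open_section_domain (a := a) (c := c) fc oW.
apply: smooth_on_eq (@smooth_on_sum _ _ _ _ r k _ oU (fun i => sW i a c aa cc)) => //.
by move=> x _; rewrite /tcoord linear_sum; apply: eq_bigr => i _; rewrite linearZ.
Qed.

Lemma smooth_sectionD m d (M : manifold R m) (N : manifold R d) (f : M -> N)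
    (W : set M) (s1 s2 : M -> 'rV[R]_d) :
  continuous f -> open W -> smooth_section f W s1 -> smooth_section f W s2 ->
  smooth_section f W (fun q => s1 q + s2 q).
Proof.
move=> fc oW sm1 sm2 a c aa cc.
have oU := open_section_domain (a := a) (c := c) fc oW.
apply: smooth_on_eq (smooth_on_lin 1 oU (sm1 a c aa cc) (sm2 a c aa cc)) => //.
by move=> x _; rewrite /tcoord linearD scale1r.
Qed.

End Charts.

(** The chain rule with a separate name [y] for the intermediate point, so that [cinv c (cmap c p)]
    can be exchanged for [p] without rewriting inside a differential. *)
Lemma diff_comp_at (R : realType) (V1 V2 V3 : normedModType R) (F : V1 -> V2)
    (G : V2 -> V3) x y v :
  F x = y -> differentiable F x -> differentiable G y ->
  differentiable (G \o F) x /\ 'd (G \o F) x v = 'd G y ('d F x v).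
Proof.
move=> <- dF dG; split; first exact: differentiable_comp.
by rewrite diff_comp.
Qed.

(** * Jacobians of the chart transitions *)

Section Transitions.
Context (R : realType) (d : nat) (N : manifold R d).
Implicit Types (a c e : chart R N d) (p : N).

Lemma transition_differentiable a c p : atlas a -> atlas c -> dom a p -> dom c p ->
  differentiable (cmap c \o cinv a) (cmap a p).
Proof.
move=> aa cc ap cp; apply: smooth_on_differentiable (atlas_compat aa cc) _.
by exists p.
Qed.

Lemma diff_cmap_cinv c p v : dom c p ->
  'd (cmap c \o cinv c) (cmap c p) v = v.
Proof.
move=> cp; have -> : 'd (cmap c \o cinv c) (cmap c p) = id :> (_ -> _).
  have idd : is_diff (cmap c p) (id : 'rV[R]_d -> 'rV[R]_d) id by exact: is_diff_id.
  rewrite -[RHS](@diff_val _ _ _ _ _ _ _ idd); apply: near_eq_diff => //.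
  apply: filterS (chart_nbhs (@filterT _ _ (nbhs_filter p)) cp) => x [_].
  by move/cinvK => /= ->.
by [].
Qed.

(** The cocycle rule. The two maps agree only near [cmap a p], where the points stay in [dom c], and
    this suffices for their differentials. *)
Lemma diff_transition_comp a c e p v :
  atlas a -> atlas c -> atlas e -> dom a p -> dom c p -> dom e p ->
  'd (cmap e \o cinv c) (cmap c p) ('d (cmap c \o cinv a) (cmap a p) v) =
  'd (cmap e \o cinv a) (cmap a p) v.
Proof.
move=> aa cc ee ap cp ep.
have dac := transition_differentiable aa cc ap cp.
have dce := transition_differentiable cc ee cp ep.
have E : (cmap c \o cinv a) (cmap a p) = cmap c p by rewrite /= cmapK.
have [dcp compE] := @diff_comp_at R 'rV[R]_d 'rV[R]_d 'rV[R]_d (cmap c \o cinv a)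
  (cmap e \o cinv c) _ _ v E dac dce.
apply: etrans (esym compE) _.
suff nE : \forall x \near cmap a p,
    ((cmap e \o cinv c) \o (cmap c \o cinv a)) x = (cmap e \o cinv a) x 
  by exact: (congr1 (fun h => h v) (esym (near_eq_diff nE dcp))).
have nc : nbhs p (dom c) by apply: open_nbhs_nbhs; split=> //; exact: dom_open.
by apply: filterS (chart_nbhs nc ap) => x [cx _] /=; rewrite cmapK.
Qed.

Lemma tcoord_at p v : tcoord (chart_at p) p v = v.
Proof. exact/diff_cmap_cinv/chart_at_dom. Qed.

Lemma tvec_at p w : tvec (chart_at p) p w = w.
Proof. exact/diff_cmap_cinv/chart_at_dom. Qed.

Lemma tvecK c p w : atlas c -> dom c p -> tcoord c p (tvec c p w) = w.
Proof.
move=> cc cp; rewrite /tcoord /tvec diff_transition_comp ?diff_cmap_cinv //;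
  by [exact: chart_at_atlas|exact: chart_at_dom].
Qed.

Lemma tcoordK c p v : atlas c -> dom c p -> tvec c p (tcoord c p v) = v.
Proof.
move=> cc cp; rewrite /tcoord /tvec diff_transition_comp ?diff_cmap_cinv //;
  by [exact: chart_at_atlas|exact: chart_at_dom].
Qed.

Lemma tvec_coord_field c p w : tvec c p w = \sum_i w 0 i *: coord_field c i p.
Proof.
rewrite {1}(row_sum_delta w) /tvec linear_sum.
by apply: eq_bigr => i _; rewrite linearZ.
Qed.

Lemma metric_tcoord (g : bilin_field N) c p u v : atlas c -> dom c p ->
  g p u v = \sum_i \sum_j metric_coef g c (cmap c p) i j *
    tcoord c p u 0 i * tcoord c p v 0 j.
Proof.
move=> cc cp; rewrite -{1}(tcoordK u cc cp) -{1}(tcoordK v cc cp).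
rewrite !tvec_coord_field bilin_suml; apply: eq_bigr => i _.
rewrite bilin_sumr; apply: eq_bigr => j _.
by rewrite bilinZl bilinZr mxE cmapK // mulrA [LHS]mulrC mulrA.
Qed.

End Transitions.

(** * The metric in coordinates and its Christoffel symbols *)

Section Metric.
Context (R : realType) (d : nat) (N : manifold R d) (g : bilin_field N).
Hypothesis gR : semi_riemannian g.

Lemma metricC p u v : g p u v = g p v u.
Proof. by have [_ gC _ _] := gR. Qed.

Lemma metric_coefC (c : chart R N d) y i j :
  metric_coef g c y i j = metric_coef g c y j i.
Proof. by rewrite !mxE metricC. Qed.

Lemma metric_coef_differentiable (c : chart R N d) q i j : atlas c -> dom c q ->
  differentiable (fun y => metric_coef g c y i j : R^o) (cmap c q).
Proof.
move=> cc cq; have [/(_ c i j cc) sG _ _ _] := gR.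
have := smooth_on_differentiable (sG c cc) (ex_intro2 _ _ q (conj cq cq) erefl).
by congr (differentiable _ _); apply/funext => y; rewrite mxE.
Qed.

(** In the preferred chart a row vector is its own tangent vector, so a vector killed by the Gram
    matrix is orthogonal to everything and vanishes by non-degeneracy. *)
Lemma metric_coef_unitmx q :
  metric_coef g (chart_at q) (cmap (chart_at q) q) \in unitmx.
Proof.
have cq : dom (chart_at q) q := chart_at_dom q.
have cc : atlas (chart_at q) := chart_at_atlas q.
rewrite -row_free_unit; apply: inj_row_free => u uG.
have [_ _ nd _] := gR; apply: (nd q) => [|v _]; first exact: memvf.
rewrite (metric_tcoord g u v cc cq) exchange_big /= big1 // => j _.
rewrite -mulr_suml.
have -> : \sum_i metric_coef g (chart_at q) (cmap (chart_at q) q) i j *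
    tcoord (chart_at q) q u 0 i = 0.
  move/rowP: uG => /(_ j); rewrite !mxE => uG; rewrite -[RHS]uG.
  by apply: eq_bigr => i _; rewrite tcoord_at mulrC.
by rewrite mul0r.
Qed.

(** Lowering the upper index cancels the inverse matrix and leaves the Christoffel symbols of the
    first kind. *)
Lemma lower_christoffel q (c := chart_at q) (y := cmap c q) l i j :
  \sum_k metric_coef g c y l k * christoffel g c y k i j =
  2^-1 * (partial_metric g c i j l y + partial_metric g c j i l y
          - partial_metric g c l i j y).
Proof.
pose S m := partial_metric g c i j m y + partial_metric g c j i m y
          - partial_metric g c m i j y.
have E n : \sum_k metric_coef g c y l k * invmx (metric_coef g c y) k n
    = (l == n)%:R.
  have /matrixP/(_ l n) := mulmxV (metric_coef_unitmx q).
  by rewrite !mxE.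
transitivity (\sum_k \sum_n
    2^-1 * (metric_coef g c y l k * invmx (metric_coef g c y) k n * S n)).
  apply: eq_bigr => k _; rewrite /christoffel mulrA mulr_sumr.
  by apply: eq_bigr => n _; rewrite -/(S n); ring.
rewrite exchange_big /=; transitivity (\sum_n 2^-1 * ((l == n)%:R * S n)).
  by apply: eq_bigr => n _; rewrite -E mulr_suml mulr_sumr.
rewrite -mulr_sumr; congr (_ * _); rewrite (bigD1 l) // eqxx mul1r /=.
by rewrite big1 ?addr0 // => n nl; rewrite eq_sym (negPf nl) mul0r.
Qed.

End Metric.

(** * The Levi-Civita connection is metric *)

Section Derivations.
Context (R : realType) (m d : nat).

Lemma is_derive_coord (y : 'rV[R]_m -> 'rV[R]_d) x u i : differentiable y x ->
  is_derive x u (fun t => y t 0 i : R^o) (('d y x u) 0 i).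
Proof.
move=> dy; have dv := @diff_derivable _ _ _ _ _ u dy.
split; first exact: (derivable_mxP y x u).1 dv 0 i.
by rewrite -(deriveE u dy) (derive_mx dv) mxE.
Qed.

Lemma is_derive_sum_fun (V : normedModType R) n (h : 'I_n -> V -> R^o) x v
    (dh : 'I_n -> R^o) :
  (forall i, is_derive x v (h i) (dh i)) ->
  is_derive x v (fun t => \sum_i h i t) (\sum_i dh i).
Proof.
move=> dhi; have -> : (fun t => \sum_i h i t) = \sum_i h i.
  by apply/funext => t; rewrite fct_sumE.
exact: is_derive_sum.
Qed.

Lemma is_derive_mul3 (h1 h2 h3 : 'rV[R]_m -> R^o) x v (d1 d2 d3 : R^o) :
  is_derive x v h1 d1 -> is_derive x v h2 d2 -> is_derive x v h3 d3 ->
  is_derive x v (fun t => h1 t * h2 t * h3 t : R^o)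
    (d1 * h2 x * h3 x + h1 x * d2 * h3 x + h1 x * h2 x * d3).
Proof.
move=> D1 D2 D3; apply: is_derive_eq (is_deriveM (is_deriveM D1 D2) D3) _.
have -> : (h1 * h2) x = h1 x * h2 x by [].
rewrite /GRing.scale /=; ring.
Qed.

Lemma is_derive_comp_partial (F : 'rV[R]_m -> 'rV[R]_d) (G : 'rV[R]_d -> R^o)
    x y u :
  F x = y -> differentiable F x -> differentiable G y ->
  is_derive x u (fun t => G (F t))
    (\sum_k ('d F x u) 0 k * 'D_(delta_mx 0 k) G y).
Proof.
move=> Fx dF dG.
have [dGF E] := @diff_comp_at R 'rV[R]_m 'rV[R]_d R^o F G x y u Fx dF dG.
split; first exact: diff_derivable dGF.
apply: etrans (deriveE u dGF) _; apply: etrans E _.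
rewrite {1}(row_sum_delta ('d F x u)) linear_sum; apply: eq_bigr => k _.
by rewrite linearZ (deriveE _ dG).
Qed.

End Derivations.

Section MetricCompatibility.
Context (R : realType) (m d : nat) (M : manifold R m) (N : manifold R d).
Context (g : bilin_field N) (f : M -> N).
Hypothesis gR : semi_riemannian g.

Lemma partial_metricC (c : chart R N d) k i j y :
  partial_metric g c k i j y = partial_metric g c k j i y.
Proof.
have E : (fun t => metric_coef g c t i j : R^o) =
    (fun t => metric_coef g c t j i : R^o).
  by apply/funext => t; exact: metric_coefC.
by rewrite /partial_metric E.
Qed.

Lemma metric_christoffel_term q v w z
    (c := chart_at q) (y := cmap c q) :
  g q z (christoffel_term g c y v w) = \sum_l \sum_i \sum_j
    z 0 l * v 0 i * w 0 j * (2^-1 * (partial_metric g c i j l y +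
      partial_metric g c j i l y - partial_metric g c l i j y)).
Proof.
rewrite (metric_tcoord g _ _ (chart_at_atlas q) (chart_at_dom q)).
rewrite !tcoord_at; apply: eq_bigr => l _.
under [RHS]eq_bigr => i _.
  under eq_bigr => j _ do rewrite -(lower_christoffel gR) mulr_sumr.
  rewrite exchange_big /=; over.
rewrite exchange_big /=; apply: eq_bigr => k _.
rewrite [christoffel_term _ _ _ _ _ 0 k]mxE mulr_sumr; apply: eq_bigr => i _.
rewrite mulr_sumr; apply: eq_bigr => j _; rewrite -/c -/y; ring.
Qed.

(** Of the six first partials in the two Christoffel terms, four cancel by symmetry of the metric
    and the other two add up to the k-th partial of the (i, j) coefficient. *)
Lemma christoffel_metric q v w z (c := chart_at q) (y := cmap c q) :
  g q (christoffel_term g c y v w) z + g q w (christoffel_term g c y v z) =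
  \sum_i \sum_j (\sum_k v 0 k * partial_metric g c k i j y) * w 0 i * z 0 j.
Proof.
rewrite (metricC gR) !metric_christoffel_term -/c -/y.
rewrite exchange_big /=.
under eq_bigr => k _ do rewrite exchange_big /=.
rewrite [X in _ + X]exchange_big /= -big_split /=.
under [RHS]eq_bigr => i _.
  under eq_bigr => j _ do rewrite -mulrA mulr_suml.
  rewrite exchange_big /=; over.
rewrite exchange_big /=; apply: eq_bigr => k _.
rewrite -big_split; apply: eq_bigr => i _.
rewrite -big_split; apply: eq_bigr => j _ /=.
rewrite (partial_metricC _ k j i) (partial_metricC _ i k j).
rewrite (partial_metricC _ j k i).
by field.
Qed.

Let c p := chart_at (f p).
Let a (p : M) := chart_at p.
Let coords p (Y : M -> 'rV[R]_d) (x : 'rV[R]_m) :=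
  tcoord (c p) (f (cinv (a p) x)) (Y (cinv (a p) x)).

(** Metric compatibility applied to the constant function g(Y, Z) = 0. Asking only for
    differentiability at the point makes it applicable to phi X and to [xi \o f], for which no more
    is established. *)
Lemma nabla_orthogonal p u (Y Z : M -> 'rV[R]_d) :
  {for p, continuous f} ->
  differentiable (cmap (c p) \o f \o cinv (a p)) (cmap (a p) p) ->
  differentiable (coords p Y) (cmap (a p) p) ->
  differentiable (coords p Z) (cmap (a p) p) ->
  (\forall q \near p, g (f q) (Y q) (Z q) = 0) ->
  g (f p) (nabla g f Y p u) (Z p) + g (f p) (Y p) (nabla g f Z p u) = 0.
Proof.
move=> cf dF dY dZ gYZ0.
set F := cmap (c p) \o f \o cinv (a p) in dF.
set x := cmap (a p) p in dF dY dZ.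
set y := cmap (c p) (f p).
have ap : dom (a p) p := chart_at_dom p.
have cp : dom (c p) (f p) := chart_at_dom (f p).
have cc : atlas (c p) := chart_at_atlas (f p).
have ax : cinv (a p) x = p by rewrite cmapK.
have Fx : F x = y by rewrite /F /= ax.
have YE : coords p Y x = Y p by rewrite /coords ax tcoord_at.
have ZE : coords p Z x = Z p by rewrite /coords ax tcoord_at.
(* The function g(Y, Z), written in the fixed charts around [p] and [f p]. *)
pose Phi (t : 'rV[R]_m) : R^o := \sum_i \sum_j metric_coef g (c p) (F t) i j *
  coords p Y t 0 i * coords p Z t 0 j.
have Phi0 : \forall t \near x, Phi t = 0.
  have nc : nbhs p (f @^-1` dom (c p)).
    by apply: cf; apply: open_nbhs_nbhs; split=> //; exact: dom_open.
  apply: filterS (chart_nbhs (filterI nc gYZ0) ap) => t [[ct g0] _].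
  by rewrite -[RHS]g0 (metric_tcoord g _ _ cc ct).
have E : 'D_u Phi x = 0 by rewrite (near_eq_derive _ Phi0) derive_cst.
pose dG i j : R^o := \sum_k ('d F x u) 0 k * partial_metric g (c p) k i j y.
have dGi i j : is_derive x u (fun t => metric_coef g (c p) (F t) i j : R^o)
    (dG i j).
  apply: (@is_derive_comp_partial _ _ _ F
    (fun s => metric_coef g (c p) s i j : R^o) x y u Fx dF).
  exact: metric_coef_differentiable.
(* The product rule gives three groups: the derivative of the metric, which [christoffel_metric]
   matches with the Christoffel terms, and those of the components of Y and of Z. *)
have dPhi : is_derive x u Phi (\sum_i \sum_j
   (dG i j * Y p 0 i * Z p 0 j +
    metric_coef g (c p) y i j * ('d (coords p Y) x u) 0 i * Z p 0 j +
    metric_coef g (c p) y i j * Y p 0 i * ('d (coords p Z) x u) 0 j)).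
  apply: is_derive_sum_fun => i; apply: is_derive_sum_fun => j.
  have dYi := is_derive_coord u i dY.
  have dZj := is_derive_coord u j dZ.
  by have := is_derive_mul3 (dGi i j) dYi dZj; rewrite Fx YE ZE.
have nablaE T : g (f p) (nabla g f Y p u) T = g (f p) ('d (coords p Y) x u) T +
    g (f p) (christoffel_term g (c p) y ('d F x u) (Y p)) T.
  by rewrite /nabla linearD add_lfunE /tangent_map lfunE.
have nablaE' T : g (f p) T (nabla g f Z p u) = g (f p) T ('d (coords p Z) x u) +
    g (f p) T (christoffel_term g (c p) y ('d F x u) (Z p)).
  by rewrite /nabla linearD /tangent_map lfunE.
have GE v w : g (f p) v w = \sum_i \sum_j
    metric_coef g (c p) y i j * v 0 i * w 0 j.
  by rewrite (metric_tcoord g v w cc cp) !tcoord_at.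
rewrite nablaE nablaE' addrACA.
apply: etrans (congr2 +%R (congr2 +%R (GE _ _) (GE _ _))
  (christoffel_metric _ _ _ _)) _.
rewrite -[RHS]E (@derive_val _ _ _ _ _ _ _ dPhi) -!big_split /=.
apply: eq_bigr => i _; rewrite -!big_split /=; apply: eq_bigr => j _.
rewrite /dG; ring.
Qed.


End MetricCompatibility.

(** * Sections along a map and pulled back covariant derivatives *)

Section AlongMaps.
Context (R : realType) (m d : nat) (M : manifold R m) (N : manifold R d).
Context (f : M -> N).

Lemma smooth_map_differentiable p : smooth_map f ->
  differentiable (cmap (chart_at (f p)) \o f \o cinv (chart_at p))
    (cmap (chart_at p) p).
Proof.
move=> [_ sf]; apply: smooth_on_differentiable (sf _ _ _ _) _.
- exact: chart_at_atlas.
- exact: chart_at_atlas.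
- by exists p => //; split; exact: chart_at_dom.
Qed.

Lemma smooth_section_differentiable (W : set M) s p : smooth_section f W s ->
  W p ->
  differentiable (fun x => tcoord (chart_at (f p)) (f (cinv (chart_at p) x))
    (s (cinv (chart_at p) x))) (cmap (chart_at p) p).
Proof.
move=> sW Wp; apply: smooth_on_differentiable (sW _ _ _ _) _.
- exact: chart_at_atlas.
- exact: chart_at_atlas.
- by exists p => //; split; [split=> //|]; exact: chart_at_dom.
Qed.

End AlongMaps.

Section LeviCivitaFacts.
Context (R : realType) (d : nat) (N : manifold R d) (g : bilin_field N).

Lemma tangent_map_id (q : N) v : tangent_map (@idfun N) q v = v.
Proof. by rewrite /tangent_map lfunE; apply/diff_cmap_cinv/chart_at_dom. Qed.

Lemma smooth_map_id : smooth_map (@idfun N).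
Proof.
split=> [x|a c aa cc]; first exact: cvg_id.
exact: atlas_compat aa cc.
Qed.

(** Near [p] the coordinates of [xi \o f] are those of [xi] composed with the local expression of
    [f], so the chain rule applies; the Christoffel terms coincide. *)
Lemma nabla_pullback m (M : manifold R m) (f : M -> N) (W : set N)
    (xi : N -> 'rV[R]_d) p u :
  smooth_map f -> smooth_section idfun W xi -> W (f p) ->
  differentiable (fun x => tcoord (chart_at (f p)) (f (cinv (chart_at p) x))
    ((xi \o f) (cinv (chart_at p) x))) (cmap (chart_at p) p) /\
  nabla g f (xi \o f) p u = nabla g idfun xi (f p) (tangent_map f p u).
Proof.
move=> sf sxi Wp.
set c := chart_at (f p); set a := chart_at p.
pose k (y : 'rV[R]_d) := tcoord c (cinv c y) (xi (cinv c y)).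
have dk : differentiable k (cmap c (f p)).
  exact: (smooth_section_differentiable sxi Wp).
have dF := smooth_map_differentiable p sf.
rewrite -/c -/a in dF; set F := _ \o cinv a in dF.
have ap : dom a p := chart_at_dom p.
have cp : dom c (f p) := chart_at_dom (f p).
have Fx : F (cmap a p) = cmap c (f p) by rewrite /F /= cmapK.
have [dkF E] := @diff_comp_at R 'rV[R]_m 'rV[R]_d 'rV[R]_d F k _ _ u Fx dF dk.
have nE : \forall x \near cmap a p, (k \o F) x =
    tcoord c (f (cinv a x)) ((xi \o f) (cinv a x)).
  have nc : nbhs p (f @^-1` dom c).
    by apply: sf.1; apply: open_nbhs_nbhs; split=> //; exact: dom_open.
  by apply: filterS (chart_nbhs nc ap) => x [cx _]; rewrite /k /F /= cmapK.
split; first exact: near_eq_differentiable nE dkF.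
rewrite /nabla tangent_map_id; congr (_ + _).
apply: etrans (congr1 (fun h => h u) (near_eq_diff nE dkF)) _.
by apply: etrans E _; rewrite /tangent_map lfunE.
Qed.

End LeviCivitaFacts.

(** Expanding [z] in the standard basis reduces the claim to products of scalar functions. *)
Lemma differentiable_scale_row (R : realType) (V : normedModType R) d
    (k : V -> R^o) (z : V -> 'rV[R]_d) x :
  differentiable k x -> differentiable z x ->
  differentiable (fun t => k t *: z t) x.
Proof.
move=> dk dz; have -> : (fun t => k t *: z t) =
    \sum_j (fun t => (k t * z t 0 j : R^o) *: delta_mx 0 j).
  apply/funext => t; rewrite fct_sumE [in LHS](row_sum_delta (z t)) scaler_sumr.
  by apply: eq_bigr => j _; rewrite scalerA.
apply: differentiable_sum => j; apply: differentiableZl.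
apply: (@differentiableM _ _ k (fun t => z t 0 j)) => //.
exact: (@differentiable_comp _ _ _ _ z (fun v : 'rV[R]_d => v 0 j : R^o) x dz
  (differentiable_coord _ _ _)).
Qed.

(** * Consequences of the nearly Sasakian identity *)

Section NearlySasakian.
Context (R : realType) (d : nat) (N : manifold R d).
Context (phi : endo_field N) (xi : N -> 'rV[R]_d) (eta : one_form N).
Context (g : bilin_field N).
Hypothesis nS : indefinite_nearly_sasakian phi xi eta g.

Let gR := ins_metric nS.

(** Since phi kills xi, the compatibility of g with phi at the pair (xi, v) reads 0 = g(xi, v) -
    eta(v). *)
Lemma etaE p v : g p v (xi p) = eta p v.
Proof.
apply/eqP; rewrite (metricC gR) -subr_eq0 -[eta p v]mul1r -(ins_eta_xi nS p).
by rewrite -(ins_compat nS) (ins_phi_xi nS) linear0 zero_lfunE.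
Qed.

Lemma phi_tvec_smooth c w : atlas c ->
  smooth_section idfun (dom c) (fun q => phi q (tvec c q w)).
Proof.
move=> cc; have -> : (fun q => phi q (tvec c q w)) =
    (fun q => \sum_i w 0 i *: phi q (coord_field c i q)).
  apply/funext => q; rewrite tvec_coord_field linear_sum.
  by apply: eq_bigr => i _; rewrite linearZ.
have oc : open (dom c) := @dom_open _ _ _ c.
apply: (@smooth_section_sum R d d N N idfun (dom c) d (w 0) _ _ oc) => [x|i].
  exact: cvg_id.
exact: (@ins_phi_smooth _ _ _ _ _ _ _ nS c i cc).
Qed.

(** Replacing phi^2 by -I + eta (x) xi avoids differentiating a composite of phi with itself: the
    field becomes a constant plus the scalar [e] times the coordinates [z] of xi. *)
Lemma phi2_tvec_differentiable q w (c := chart_at q) :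
  differentiable (fun x => tcoord c (cinv c x)
    (phi (cinv c x) (phi (cinv c x) (tvec c (cinv c x) w)))) (cmap c q).
Proof.
have cq : dom c q := chart_at_dom q.
have cc : atlas c := chart_at_atlas q.
pose e x : R^o := \sum_i w 0 i *: (eta (cinv c x) (coord_field c i (cinv c x)) : R^o).
pose z x := tcoord c (cinv c x) (xi (cinv c x)).
have de : differentiable e (cmap c q).
  have -> : e = \sum_i (w 0 i *: (fun x => eta (cinv c x) (coord_field c i (cinv c x)) : R^o)).
    by apply/funext => x; rewrite fct_sumE.
  apply: differentiable_sum => i; apply: differentiableZ.
  apply: smooth_on_differentiable (ins_eta_smooth nS i cc cc) _.
  by exists q.
have dz : differentiable z (cmap c q).
  exact: (smooth_section_differentiable (ins_xi_smooth nS)).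
apply: (@near_eq_differentiable _ _ _ (cst (- w) + (fun x => e x *: z x))); last first.
  apply: differentiableD; first exact: differentiable_cst.
  exact: differentiable_scale_row de dz.
have nc : nbhs q (dom c) by apply: open_nbhs_nbhs; split=> //; exact: (@dom_open _ _ _ c).
apply: filterS (chart_nbhs nc cq) => x [cx _].
rewrite (ins_phi2 nS) /tcoord linearD linearN linearZ -/(tcoord _ _ _) tvecK //.
rewrite -/(tcoord _ _ _) tvec_coord_field linear_sum.
congr (_ + _ *: _); rewrite /e.
by apply: eq_bigr => i _; rewrite linearZ.
Qed.

(* The nearly Sasakian identity for a single field X through phi w, with
   eta X = 0, gives eta (nabla_X (phi X)) = g X X; differentiating
   g (phi X) xi = 0 moves the derivative onto xi. *)
Lemma metric_nabla_xi q w : eta q w = 0 ->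
  g q w (nabla g idfun xi q (phi q w)) = g q w w.
Proof.
move=> ew; pose c := chart_at q.
have cq : dom c q := chart_at_dom q.
have cc : atlas c := chart_at_atlas q.
(* [w] is extended with constant coordinates in [c]; applying phi makes eta X vanish wherever X is
   considered. *)
pose X p := phi p (tvec c p w).
have Xq : X q = phi q w by rewrite /X tvec_at.
have phi2w : phi q (phi q w) = - w by rewrite (ins_phi2 nS) ew scale0r addr0.
have eX : eta q (nabla g idfun (fun p => phi p (X p)) q (phi q w)) = g q w w.
  have := ins_nearly_sasakian nS (@dom_open _ _ _ c) (phi_tvec_smooth w cc)
    (phi_tvec_smooth w cc) cq.
  rewrite -/X -/(X q) Xq (ins_eta_phi nS) !scale0r !subr0.
  have etaEndo : eta q (nabla_endo g phi X X q) =
      eta q (nabla g idfun (fun p => phi p (X p)) q (phi q w)).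
    by rewrite /nabla_endo Xq linearB /= (ins_eta_phi nS) subr0.
  move/(congr1 (eta q)); rewrite linearD /= etaEndo linearZ /= (ins_eta_xi nS).
  (* On the pair (X, X) both sides carry a factor 2, and g(phi w, phi w) = g(w, w) because eta w =
     0. *)
  rewrite (ins_compat nS) ew mul0r subr0 /GRing.scale /= mulr1; lra.
have dF := smooth_map_differentiable q (@smooth_map_id _ _ N).
have ds := @smooth_section_differentiable R d d N N idfun setT xi q
  (ins_xi_smooth nS) I.
have := @nabla_orthogonal R d d N N g idfun gR q (phi q w) (fun p => phi p (X p)) xi
  (@cvg_id _ _) dF (phi2_tvec_differentiable q w) ds.
rewrite etaE eX Xq phi2w linearN opp_lfunE => E.
have /E/eqP : \forall p \near q, g p (phi p (X p)) (xi p) = 0.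
  by near=> p; rewrite etaE (ins_eta_phi nS).
by rewrite subr_eq0 => /eqP ->.
Unshelve. all: by end_near. Qed.

End NearlySasakian.

(** * Totally geodesic lightlike submanifolds *)

Section TotallyGeodesic.
Context (R : realType) (m d : nat) (M : manifold R m) (N : manifold R d).
Context (phi : endo_field N) (xi : N -> 'rV[R]_d) (eta : one_form N).
Context (g : bilin_field N) (f : M -> N).
Context (STM STMperp ltr : M -> {vspace 'rV[R]_d}).
Hypothesis nS : indefinite_nearly_sasakian phi xi eta g.
Hypothesis lM : lightlike_submanifold g f STM STMperp ltr.
Hypothesis tx : tangent_to f xi.
Hypothesis tg : totally_geodesic g f STMperp ltr.

Let gR := ins_metric nS.

(** Makes the projection in [second_fundamental_form] one along a true complement, so that h(X, Y) =
    0 forces the covariant derivative of Y to be tangent. *)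
Lemma transversal_decomposition p :
  ((tr STMperp ltr p) :&: TM f p = 0)%VS /\
  (tr STMperp ltr p + TM f p = fullv)%VS.
Proof.
have [_ [r [_ _ _ [_ dsP _] lt]]] := lM.
have [W [E [N' [_ Wp _ /(_ p Wp) [bE bN _ EN _]]]]] := lt p.
by apply: (transversal_complement _ (dsP p) bE bN EN); exact: metricC.
Qed.

Lemma TMperp_metric p w v : w \in TMperp g f p -> v \in TM f p ->
  g (f p) w v = 0.
Proof. by move=> /mem_orthv wP vT; rewrite (metricC gR) wP. Qed.

(* xi and the constant coefficient combination Y of the local frames of Rad TM
   and S(TM) agree at p, and both are orthogonal to the section Wt through w.
   Since nabla Y is tangent to M, w is orthogonal to it, so nabla Wt is
   orthogonal to Y p = xi p, whence w is orthogonal to nabla xi.  Using Y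
   avoids proving that xi restricted to M is smooth to all orders. *)
Lemma totally_geodesic_metric_nabla (S : M -> {vspace 'rV[R]_d}) p w x :
  subbundle f S -> (forall q, (S q <= TMperp g f q)%VS) ->
  w \in S p -> x \in STM p ->
  g (f p) w (nabla g idfun xi (f p) x) = 0.
Proof.
move=> [kS sS] SP wS xS.
have [[sf _ _] [r [_ sR [[kT sT] dsT _] _ _]]] := lM.
have cf : continuous f := sf.1.
have STMT q v : v \in STM q -> v \in TM f q.
  by rewrite -(dsT q).1; apply/subvP/addvSr.
have RT q v : v \in Rad g f q -> v \in TM f q.
  by rewrite -(dsT q).1; apply/subvP/addvSl.
have [W1 [s1 [oW1 W1p sm1 b1]]] := sR p.
have [W2 [s2 [oW2 W2p sm2 b2]]] := sT p.
have [W3 [s3 [oW3 W3p sm3 b3]]] := sS p.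
pose W := W1 `&` W2 `&` W3.
have oW : open W by apply: openI => //; exact: openI.
have Wp : W p by split.
have nW : nbhs p W by apply: open_nbhs_nbhs.
have WW1 : W `<=` W1 by move=> q [[]].
have WW2 : W `<=` W2 by move=> q [[]].
have WW3 : W `<=` W3 by move=> q [].
have [aw wE] := basis_tuple_sum (b3 p W3p) wS.
have [ax xE] := basis_tuple_sum (b2 p W2p) xS.
have : xi (f p) \in (Rad g f p + STM p)%VS by rewrite (dsT p).1; exact: tx.
move=> /memv_addP[y1 y1R [y2 y2S y12]].
have [a1 y1E] := basis_tuple_sum (b1 p W1p) y1R.
have [a2 y2E] := basis_tuple_sum (b2 p W2p) y2S.
pose Wt q := \sum_i aw i *: s3 i q.
pose X q := \sum_i ax i *: s2 i q.
pose Y q := \sum_i a1 i *: s1 i q + \sum_i a2 i *: s2 i q.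
have smW : smooth_section f W Wt.
  apply: (@smooth_section_sum _ _ _ _ _ _ _ _ _ _ cf oW) => i; exact: smooth_section_sub WW3 (sm3 i).
have smX : smooth_section f W X.
  apply: (@smooth_section_sum _ _ _ _ _ _ _ _ _ _ cf oW) => i; exact: smooth_section_sub WW2 (sm2 i).
have smY : smooth_section f W Y.
  apply: (@smooth_sectionD _ _ _ _ _ _ _ _ _ cf oW);
    apply: (@smooth_section_sum _ _ _ _ _ _ _ _ _ _ cf oW) => i.
    exact: smooth_section_sub WW1 (sm1 i).
  exact: smooth_section_sub WW2 (sm2 i).
have WtP q : W q -> Wt q \in TMperp g f q.
  move=> /WW3 Wq; apply/(subvP (SP q))/memv_suml => i _.
  exact/memvZ/(basis_tuple_mem (b3 q Wq)).
have XT q : W q -> X q \in TM f q.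
  move=> /WW2 Wq; apply/STMT/memv_suml => i _.
  exact/memvZ/(basis_tuple_mem (b2 q Wq)).
have YT q : W q -> Y q \in TM f q.
  move=> Wq; apply: memvD; apply: memv_suml => i _; apply: memvZ.
    exact/RT/(basis_tuple_mem (b1 q (WW1 q Wq))).
  exact/STMT/(basis_tuple_mem (b2 q (WW2 q Wq))).
have Wtp : Wt p = w by rewrite [RHS]wE.
have Xp : X p = x by rewrite [RHS]xE.
have Yp : Y p = xi (f p) by rewrite y12 y1E y2E.
(* The same preimage as in [second_fundamental_form]; it maps back to [x] because [x] is tangent to
   M. *)
pose u := ((tangent_map f p)^-1%VF x).
have ux : tangent_map f p u = x by rewrite limg_lfunVK //; exact: STMT.
have nYT : nabla g f Y p u \in TM f p.
  have [d1 d2] := transversal_decomposition p.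
  apply: (daddv_pi_eq0 d1 d2); rewrite /u -Xp.
  by apply: (tg oW smX smY _ Wp) => q Wq; split; [exact: XT|exact: YT].
have dF := smooth_map_differentiable p sf.
have dW := smooth_section_differentiable smW Wp.
have dY := smooth_section_differentiable smY Wp.
have [dxi xiE] := @nabla_pullback R d N g m M f setT xi p u sf
  (ins_xi_smooth nS) I.
(* Since [Y p] is xi at [f p], both identities contain g(nabla Wt, xi). The first shows that this
   term is zero, which leaves g(w, nabla xi) = 0 in the second. *)
have E1 := @nabla_orthogonal R m d M N g f gR p u Wt Y (cf p) dF dW dY.
have E2 := @nabla_orthogonal R m d M N g f gR p u Wt (xi \o f) (cf p) dF dW dxi.
have {}E1 : g (f p) (nabla g f Wt p u) (xi (f p)) = 0.
  rewrite -Yp -[RHS]E1; last first.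
    by apply: filterS nW => q Wq; rewrite TMperp_metric ?WtP ?YT.
  by rewrite (TMperp_metric (WtP p Wp) nYT) addr0.
have {}E2 : g (f p) (nabla g f Wt p u) (xi (f p)) +
    g (f p) (Wt p) (nabla g f (xi \o f) p u) = 0.
  by apply: E2; apply: filterS nW => q Wq; apply: TMperp_metric (WtP q Wq) (tx q).
by move: E2; rewrite E1 add0r Wtp xiE ux.
Qed.

Lemma totally_geodesic_not_proper : ~ proper_qgcr g f phi STM STMperp ltr.
Proof.
move=> [D1 [D2 [D0 [Dbar [L [S [Q [_ _ _ [p Sp]]]]]]]]].
have [_ [r [_ _ [_ dsT ndT] [_ dsP _] lt]]] := lM.
apply: Sp; apply/eqP; rewrite -subv0; apply/subvP => w wS; rewrite memv0; apply/eqP.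
have SP q : (S q <= TMperp g f q)%VS.
  apply: subv_trans (qgcr_S_sub Q q) _; rewrite -(dsP q).1; exact: addvSr.
have eS v : v \in S p -> eta (f p) v = 0.
  by move=> /(subvP (SP p)) vP; rewrite -(etaE nS); apply: TMperp_metric (tx p).
have phiST v : v \in S p -> phi (f p) v \in (phi (f p) @: D2 p + Dbar p)%VS.
  move=> vS; rewrite (qgcr_Dbar_eq Q); apply: (subvP (addvSr _ _)).
  by apply: (subvP (addvSl _ _)); exact: memv_img.
have phiSTM v : v \in S p -> phi (f p) v \in STM p.
  move=> /phiST; rewrite (qgcr_screen Q); exact/subvP/addvSl.
have g0 v : v \in S p -> g (f p) v v = 0.
  move=> vS; rewrite -(metric_nabla_xi nS (eS v vS)).
  exact: (totally_geodesic_metric_nabla (qgcr_S Q) SP vS (phiSTM v vS)).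
have gS v : v \in S p -> g (f p) w v = 0.
  move=> vS; have := g0 _ (memvD wS vS).
  (* Polarization: only twice g(w, v) survives in the expansion of g(w + v, w + v) = 0. *)
  rewrite bilinDr !bilinDl (g0 w wS) (g0 v vS) (metricC gR (f p) v w) addr0 add0r.
  move/eqP; rewrite -mulr2n mulrn_eq0 /= => /eqP //.
have phiw0 : phi (f p) w = 0.
  apply: (ndT p) (phiSTM w wS) _ => v; rewrite (qgcr_screen Q).
  move=> /memv_addP[v1 v1D [v0 v0D ->]].
  rewrite bilinDr (qgcr_orth Q (phiST w wS) v0D) addr0.
  move: v1D => /memv_addP[_ /memv_imgP[e eD2 ->] [v2 v2D ->]].
  move: v2D; rewrite (qgcr_Dbar_eq Q).
  move=> /memv_addP[_ /memv_imgP[s sS ->] [_ /memv_imgP[l lL ->] ->]].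
  (* As eta w = 0, phi drops out of each pairing, leaving [w] against [e], [s] and [l]. *)
  rewrite !bilinDr !(ins_compat nS) (eS w wS) !mul0r !subr0 (gS s sS) add0r.
  have wP := subvP (SP p) w wS.
  rewrite (TMperp_metric wP) ?add0r; last first.
    have : e \in Rad g f p by rewrite -(qgcr_rad Q p).1; apply: (subvP (addvSr _ _)).
    by rewrite memv_cap => /andP[].
  (* [l] is a combination of the null sections [N' i], which are orthogonal to S(TM^perp) and hence
     to [w]. *)
  have [W [E [N' [_ Wp _ /(_ p Wp) [_ bN oN _ _]]]]] := lt p.
  have [a ->] := basis_tuple_sum bN (subvP (qgcr_L_sub Q p) l lL).
  rewrite bilin_sumr big1 // => i _; rewrite bilinZr.
  have [_ /mem_orthv ->] := oN i; first by rewrite mulr0.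
  exact: (subvP (qgcr_S_sub Q p)).
have := ins_phi2 nS (f p) w; rewrite phiw0 linear0 (eS w wS) scale0r addr0.
by move/eqP; rewrite eq_sym oppr_eq0 => /eqP.
Qed.

End TotallyGeodesic.

Theorem corollary4p2 (R : realType) (n : nat) (Mbar : manifold R (2 * n + 1))
    (phi : endo_field Mbar) (xi : Mbar -> 'rV[R]_(2 * n + 1))
    (eta : one_form Mbar) (g : bilin_field Mbar) :
  indefinite_nearly_sasakian phi xi eta g ->
  ~ exists (m : nat) (M : manifold R m) (f : M -> Mbar)
      (STM STMperp ltr : M -> {vspace 'rV[R]_(2 * n + 1)}),
      [/\ lightlike_submanifold g f STM STMperp ltr,
          proper_qgcr g f phi STM STMperp ltr,
          tangent_to f xi &
          totally_geodesic g f STMperp ltr].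
Proof.
move=> nS [m [M [f [STM [STMperp [ltr [lM pM tx tg]]]]]]].
exact: totally_geodesic_not_proper nS lM tx tg pM.
Qed.
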